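(* There exists an absolute constant $c$ (in particular independent of $\mu$, $\delta$ and $\epsilon$) such that the following holds. Let $M$ be an ergodic Markov chain (not necessarily reversible) with finite state space $[n]$ and stationary distribution $\pi$. Let $0<\epsilon\le 1/8$ and let $T=T(\epsilon)$ be the $\epsilon$-mixing time of $M$. Let $(V_1,\dots,V_t)$ denote a $t$-step random walk on $M$ starting from an initial distribution $\varphi$ on $[n]$, i.e., $V_1\leftarrow\varphi$. For every $i\in[t]$, let $f_i:[n]\to[0,1]$ be a weight function at step $i$ such that $\mathrm{E}_{v\leftarrow\pi}[f_i(v)]=\mu$ for all $i$. Define the total weight of the walk by $X=\sum_{i=1}^t f_i(V_i)$. Then: 1. $\Pr[X\ge(1+\delta)\mu t]\le c\,\|\varphi\|_\pi\exp\left(-\delta^2\mu t/(72T)\right)$ for $0\le\delta\le1$, and $\Pr[X\ge(1+\delta)\mu t]\le c\,\|\varphi\|_\pi\exp\left(-\delta\mu t/(72T)\right)$ for $\delta>1$; 2. $\Pr[X\le(1-\delta)\mu t]\le c\,\|\varphi\|_\pi\exp\left(-\delta^2\mu t/(72T)\right)$ for $0\le\delta\le1$.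
   Context: $M$ denotes both the discrete-time Markov chain and its transition matrix; $M_{i,j}$ is the probability of moving from $i$ to $j$ in one step, and distributions are row vectors. Total variation distance: $\|u-w\|_{TV}=\max_{A\subseteq[n]}|\sum_{i\in A}u_i-\sum_{i\in A}w_i|=\frac12\|u-w\|_1$. The $\epsilon$-mixing time is $T(\epsilon)=\min\{t\ge1:\max_x\|xM^t-\pi\|_{TV}\le\epsilon\}$, where $t$ ranges over positive integers and $x$ over all probability distributions on $[n]$. The inner product under the $\pi$-kernel on $\mathbb{R}^n$ is $\langle u,v\rangle_\pi=\sum_{i\in[n]}u_iv_i/\pi(i)$, and the $\pi$-norm is $\|u\|_\pi=\sqrt{\langle u,u\rangle_\pi}$. *)

(* Defs.v *)
From HB Require Import structures.
From mathcomp Require Import all_boot all_order all_algebra.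
From mathcomp Require Import all_classical all_reals all_analysis.

Set Implicit Arguments.
Unset Strict Implicit.
Unset Printing Implicit Defensive.

Import Order.TTheory GRing.Theory Num.Theory.

Local Open Scope classical_set_scope.
Local Open Scope ring_scope.

Definition is_distribution (R : realType) (n : nat) (u : 'rV[R]_n) : Prop :=
  (forall i, 0 <= u 0 i) /\ \sum_i u 0 i = 1.

Definition is_transition_matrix (R : realType) (n : nat) (M : 'M[R]_n) : Prop :=
  forall i, is_distribution (row i M).

Definition is_irreducible (R : realType) (n : nat) (M : 'M[R]_n) : Prop :=
  forall i j, exists k : nat, 0 < (M ^+ k) i j.

(* The gcd of the set of return times {k >= 1 | (M ^+ k) i i > 0} is 1. *)
Definition is_aperiodic (R : realType) (n : nat) (M : 'M[R]_n) : Prop :=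
  forall (i : 'I_n) (d : nat),
    (forall k : nat, (0 < k)%N -> 0 < (M ^+ k) i i -> (d %| k)%N) -> d = 1%N.

Definition is_ergodic (R : realType) (n : nat) (M : 'M[R]_n) : Prop :=
  [/\ is_transition_matrix M, is_irreducible M & is_aperiodic M].

Definition is_stationary (R : realType) (n : nat) (M : 'M[R]_n)
    (pi : 'rV[R]_n) : Prop :=
  is_distribution pi /\ pi *m M = pi.

(* The default value 0 of the iterated maximum is attained at A = set0. *)
Definition tv_dist (R : realType) (n : nat) (u w : 'rV[R]_n) : R :=
  \big[Num.max/0]_(A : {set 'I_n})
    `|\sum_(i in A) u 0 i - \sum_(i in A) w 0 i|.

(* max_x || x M^k - pi ||_TV <= eps, x ranging over all distributions. *)
Definition mixed_at (R : realType) (n : nat) (M : 'M[R]_n) (pi : 'rV[R]_n)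
    (eps : R) (k : nat) : Prop :=
  forall x : 'rV[R]_n, is_distribution x -> tv_dist (x *m M ^+ k) pi <= eps.

Definition is_mixing_time (R : realType) (n : nat) (M : 'M[R]_n)
    (pi : 'rV[R]_n) (eps : R) (T : nat) : Prop :=
  [/\ (1 <= T)%N, mixed_at M pi eps T &
      forall k : nat, (1 <= k)%N -> mixed_at M pi eps k -> (T <= k)%N].

Definition pi_inner (R : realType) (n : nat) (pi u v : 'rV[R]_n) : R :=
  \sum_i u 0 i * v 0 i / pi 0 i.

Definition pi_norm (R : realType) (n : nat) (pi u : 'rV[R]_n) : R :=
  Num.sqrt (pi_inner pi u u).

Definition mean (R : realType) (n : nat) (pi : 'rV[R]_n) (g : 'I_n -> R) : R :=
  \sum_v pi 0 v * g v.

(* The walk (V_1, ..., V_t) is indexed from 0: V_(i+1) is [V i] for i : 'I_t.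
   The Markov property is stated in product form, so that no conditioning on
   null events occurs. *)
Definition is_random_walk (R : realType) (n t : nat) (d : measure_display)
    (Omega : measurableType d) (P : probability Omega R)
    (M : 'M[R]_n) (phi : 'rV[R]_n) (V : 'I_t -> Omega -> 'I_n) : Prop :=
  [/\ forall i x, measurable (V i @^-1` [set x]),
      forall i : 'I_t, i = 0%N :> nat ->
        forall x, P (V i @^-1` [set x]) = (phi 0 x)%:E
    & forall i j : 'I_t, j = i.+1 :> nat -> forall v : 'I_t -> 'I_n,
        P [set w | forall k : 'I_t, (k <= j)%N -> V k w = v k] =
        (P [set w | forall k : 'I_t, (k <= i)%N -> V k w = v k]
         * (M (v i) (v j))%:E)%E].

Definition total_weight (R : realType) (n t : nat) (Omega : Type)
    (f : 'I_t -> 'I_n -> R) (V : 'I_t -> Omega -> 'I_n) (w : Omega) : R :=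
  \sum_(i < t) f i (V i w).

(* Main.v *)
(* Along a period of T steps the chain halves the pi-norm of a vector of total
   mass 0: the rows of M^T are within 2 eps <= 1/4 of pi in l1, so N = M^T
   contracts the l1 norm of such vectors by 1/4; iterating the self-adjoint
   operator N N~ transfers this rate to the pi-norm of N N~, whose square root
   is the rate 1/2 of N.

   By convexity, E exp (s X / T) is at most the average over h < T of
   E exp (s X_h), where X_h only collects the weights at times congruent to h
   modulo T. Each of these is a product of transfer matrices, estimated through
   the potential |mass| + const * (pi-norm of the fluctuation around pi), which
   grows by a factor at most 1 + s mu + 10 s^2 mu per collected weight as long as
   |s| <= 1/18. Markov's inequality with s = delta / 18, 1 / 18 and - delta / 18
   gives the three bounds. *)
Require Import Defs.
From HB Require Import structures.
From mathcomp Require Import all_boot all_order all_algebra.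
From mathcomp Require Import all_classical all_reals all_analysis.
From mathcomp Require Import zify ring lra.

Set Implicit Arguments.
Unset Strict Implicit.
Unset Printing Implicit Defensive.

Import Order.TTheory GRing.Theory Num.Theory.

Local Open Scope classical_set_scope.
Local Open Scope ring_scope.

(** * Geometry of the pi-norm; splitting a vector into mass and fluctuation *)

Section PiNorm.
Variables (R : realType) (n : nat) (pi : 'rV[R]_n).
Hypothesis pi_gt0 : forall i, 0 < pi 0 i.
Implicit Types u v w : 'rV[R]_n.

Lemma pi_innerC u v : pi_inner pi u v = pi_inner pi v u.
Proof. by apply: eq_bigr => i _; rewrite [u 0 i * _]mulrC. Qed.

Lemma pi_innerDl u v w :
  pi_inner pi (u + v) w = pi_inner pi u w + pi_inner pi v w.
Proof. by rewrite -big_split; apply: eq_bigr => i _; rewrite mxE !mulrDl. Qed.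

Lemma pi_innerZl a u v : pi_inner pi (a *: u) v = a * pi_inner pi u v.
Proof. by rewrite big_distrr; apply: eq_bigr => i _ /=; rewrite mxE !mulrA. Qed.

Lemma pi_innerDr u v w :
  pi_inner pi w (u + v) = pi_inner pi w u + pi_inner pi w v.
Proof. by rewrite !(pi_innerC w) pi_innerDl. Qed.

Lemma pi_innerZr a u v : pi_inner pi v (a *: u) = a * pi_inner pi v u.
Proof. by rewrite !(pi_innerC v) pi_innerZl. Qed.

Lemma pi_inner_ge0 u : 0 <= pi_inner pi u u.
Proof.
by apply: sumr_ge0 => i _; rewrite mulr_ge0 ?invr_ge0 ?(ltW (pi_gt0 i)) // -expr2 sqr_ge0.
Qed.

(** The quadratic form [h] at [(B, - C)] equals [B * (A * B - C ^+ 2)], which settles the case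
    [0 < B]. *)
Lemma pi_CauchySchwarz_sqr u v :
  pi_inner pi u v ^+ 2 <= pi_inner pi u u * pi_inner pi v v.
Proof.
have h a b : 0 <= a ^+ 2 * pi_inner pi u u + 2 * a * b * pi_inner pi u v
    + b ^+ 2 * pi_inner pi v v.
  have := pi_inner_ge0 (a *: u + b *: v).
  rewrite !(pi_innerDl, pi_innerDr, pi_innerZl, pi_innerZr) (pi_innerC v u).
  by congr (_ <= _); ring.
have := pi_inner_ge0 u; have := pi_inner_ge0 v.
move: (pi_inner pi u u) (pi_inner pi v v) (pi_inner pi u v) h => A B C h B0 A0.
have h1 := h B (- C); have h2 := h (- C) A.
have [Bp|] := ltP 0 B.
  have : 0 <= B * (A * B - C ^+ 2) 
    by apply: le_trans h1 _; rewrite le_eqVlt; apply/orP; left; apply/eqP; ring.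
  by rewrite pmulr_rge0 // subr_ge0.
(* For [B = 0] the form at [(- C, A + 1)] is [- C ^+ 2 * (A + 2)], which forces [C ^+ 2 <= 0]. *)
move=> Bn; have {}B0 : B = 0 by lra.
have := h (- C) (A + 1); rewrite B0 => h3.
have : 0 <= - C ^+ 2 * (A + 2).
  apply: le_trans h3 _; rewrite le_eqVlt; apply/orP; left; apply/eqP; ring.
rewrite mulNr oppr_ge0 mulr0 pmulr_lle0 //; lra.
Qed.

Lemma pi_norm_ge0 u : 0 <= pi_norm pi u.
Proof. exact: sqrtr_ge0. Qed.

Lemma pi_norm_sqr u : pi_norm pi u ^+ 2 = pi_inner pi u u.
Proof. by rewrite sqr_sqrtr // pi_inner_ge0. Qed.

Lemma pi_norm_le u x : 0 <= x -> pi_inner pi u u <= x ^+ 2 -> pi_norm pi u <= x.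
Proof.
move=> x0 ux.
by rewrite -(ler_pXn2r (ltn0Sn 1)) ?nnegrE ?pi_norm_ge0 // pi_norm_sqr.
Qed.

Lemma pi_CauchySchwarz u v : `|pi_inner pi u v| <= pi_norm pi u * pi_norm pi v.
Proof.
rewrite -(ler_pXn2r (ltn0Sn 1)) ?nnegrE ?mulr_ge0 ?pi_norm_ge0 //.
by rewrite -normrX ger0_norm ?sqr_ge0 // exprMn !pi_norm_sqr pi_CauchySchwarz_sqr.
Qed.

Lemma pi_normD u v : pi_norm pi (u + v) <= pi_norm pi u + pi_norm pi v.
Proof.
apply: pi_norm_le; first by rewrite addr_ge0 ?pi_norm_ge0.
rewrite pi_innerDl !pi_innerDr (pi_innerC v u) sqrrD !pi_norm_sqr.
have := le_trans (ler_norm _) (pi_CauchySchwarz u v).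
rewrite mulr2n; lra.
Qed.

Lemma pi_normZ a u : pi_norm pi (a *: u) = `|a| * pi_norm pi u.
Proof.
by rewrite /pi_norm pi_innerZl pi_innerZr mulrA -expr2 sqrtrM ?sqr_ge0 // sqrtr_sqr.
Qed.

Definition mass u := \sum_i u 0 i.
(** When [pi] has mass 1, this is the component of [u] orthogonal to [pi]: the inner product with
    [pi] is the mass. *)
Definition fluct u := u - mass u *: pi.
Definition reweight (g : 'I_n -> R) u : 'rV[R]_n := \row_i (u 0 i * g i).

Hypothesis pi1 : mass pi = 1.

Lemma massD u v : mass (u + v) = mass u + mass v.
Proof. by rewrite /mass -big_split; apply: eq_bigr => i _; rewrite mxE. Qed.

Lemma massZ a u : mass (a *: u) = a * mass u.
Proof. by rewrite /mass big_distrr; apply: eq_bigr => i _ /=; rewrite mxE. Qed.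

Lemma mass_inner u : mass u = pi_inner pi u pi.
Proof. by apply: eq_bigr => i _; rewrite mulfK // gt_eqF. Qed.

Lemma mass_fluct u : mass (fluct u) = 0.
Proof. by rewrite massD -scaleNr massZ pi1 mulr1 subrr. Qed.

Lemma fluctE u : u = mass u *: pi + fluct u.
Proof. by rewrite addrC subrK. Qed.

Lemma fluctD u v : fluct (u + v) = fluct u + fluct v.
Proof. by rewrite /fluct massD scalerDl opprD addrACA. Qed.

Lemma fluctZ a u : fluct (a *: u) = a *: fluct u.
Proof. by rewrite /fluct massZ scalerBr scalerA. Qed.

Lemma fluct_pi : fluct pi = 0.
Proof. by rewrite /fluct pi1 scale1r subrr. Qed.

Lemma pi_inner_pi : pi_inner pi pi pi = 1.
Proof. by rewrite -mass_inner. Qed.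

(** Pythagoras for the orthogonal splitting [fluctE]. *)
Lemma pi_norm_fluct u : pi_norm pi (fluct u) <= pi_norm pi u.
Proof.
apply: pi_norm_le; first exact: pi_norm_ge0.
rewrite pi_norm_sqr {3 4}(fluctE u).
move: (fluct u) (mass_fluct u) => q; rewrite mass_inner => hq.
rewrite !(pi_innerDl, pi_innerDr, pi_innerZl, pi_innerZr) (pi_innerC pi q) hq pi_inner_pi.
have := sqr_ge0 (mass u); rewrite expr2; lra.
Qed.

Lemma mass_le_norm u : `|mass u| <= pi_norm pi u.
Proof.
rewrite mass_inner (le_trans (pi_CauchySchwarz _ _)) //.
by rewrite {2}/pi_norm pi_inner_pi sqrtr1 mulr1.
Qed.

Lemma reweightD g u v : reweight g (u + v) = reweight g u + reweight g v.
Proof. by apply/rowP => i; rewrite !mxE mulrDl. Qed.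

Lemma reweightZ g a u : reweight g (a *: u) = a *: reweight g u.
Proof. by apply/rowP => i; rewrite !mxE mulrA. Qed.

Lemma pi_norm_reweight g c u : 0 <= c -> (forall i, `|g i| <= c) ->
  pi_norm pi (reweight g u) <= c * pi_norm pi u.
Proof.
move=> c0 gc; apply: pi_norm_le; first by rewrite mulr_ge0 ?pi_norm_ge0.
rewrite exprMn pi_norm_sqr big_distrr; apply: ler_sum => i _ /=.
rewrite !mxE.
rewrite (_ : _ / _ = g i ^+ 2 * (u 0 i * u 0 i / pi 0 i)); last by ring.
apply: ler_wpM2r; first by rewrite mulr_ge0 ?invr_ge0 ?(ltW (pi_gt0 i)) // -expr2 sqr_ge0.
by rewrite -[g i ^+ 2]ger0_norm ?sqr_ge0 // normrX lerXn2r ?nnegrE.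
Qed.

(* The coefficients of the fluctuation are [2 * b] after and [4 * b] before the
   reweighting, since the chain halves it between two reweightings. *)
Lemma potential_reweight g p b c G z :
  0 <= b -> 0 <= c -> (forall i, `|g i| <= c) -> `|mass (reweight g pi)| <= p ->
  pi_norm pi (reweight (fun i => g i - 1) pi) <= b ->
  p + 2 * b ^+ 2 <= G -> 1 + 2 * c <= 4 * G ->
  `|mass (reweight g z)| + 2 * b * pi_norm pi (fluct (reweight g z)) <=
  G * (`|mass z| + 4 * b * pi_norm pi (fluct z)).
Proof.
move=> b0 c0 gc gp gb pG cG; set q := fluct z; set a := mass z.
have q0 : mass q = 0 by exact: mass_fluct.
have E : reweight g z = a *: reweight g pi + reweight g q.
  by rewrite -reweightZ -reweightD -fluctE.
(* As [q] has mass 0, [g] may be replaced by [g - 1], so the mass created out of [q] is small with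
   [b]. *)
have mq : `|mass (reweight g q)| <= b * pi_norm pi q.
  rewrite (_ : mass _ = pi_inner pi (reweight (fun i => g i - 1) pi) q).
    exact: le_trans (pi_CauchySchwarz _ _) (ler_wpM2r (pi_norm_ge0 _) gb).
  rewrite -[LHS]subr0 -q0 /mass -sumrB; apply: eq_bigr => i _; rewrite mxE [reweight _ _ 0 i]mxE.
  by field; rewrite gt_eqF.
(* Reweighting [pi] by [g] or by [g - 1] differs by [pi] itself, which has no fluctuation. *)
have fp : pi_norm pi (fluct (reweight g pi)) <= b.
  apply: le_trans _ gb.
  rewrite (_ : fluct _ = fluct (reweight (fun i => g i - 1) pi)) ?pi_norm_fluct //.
  rewrite (_ : reweight g pi = reweight (fun i => g i - 1) pi + pi) ?fluctD ?fluct_pi ?addr0 //.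
  by apply/rowP => i; rewrite !mxE; ring.
have fq := le_trans (pi_norm_fluct (reweight g q)) (pi_norm_reweight q c0 gc).
rewrite E massD massZ fluctD fluctZ.
have h1 : `|a * mass (reweight g pi) + mass (reweight g q)| <= `|a| * p + b * pi_norm pi q.
  by apply: le_trans (ler_normD _ _) _; rewrite lerD // normrM ler_wpM2l.
have h2 : pi_norm pi (a *: fluct (reweight g pi) + fluct (reweight g q)) <=
   `|a| * b + c * pi_norm pi q.
  by apply: le_trans (pi_normD _ _) _; rewrite lerD // pi_normZ ler_wpM2l.
have {}h2 := ler_wpM2l (mulr_ge0 (ler0n R 2) b0) h2.
(* In the total, [|a|] has coefficient [p + 2 * b ^+ 2] and the norm of [q] has
   [b * (1 + 2 * c)]. *)
have h3 := ler_wpM2l (normr_ge0 a) pG.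
have h4 := ler_wpM2l (mulr_ge0 b0 (pi_norm_ge0 q)) cG.
nra.
Qed.

End PiNorm.

(** * Stochastic matrices: contraction in l1, then in the pi-norm *)

Section Chain.
Variables (R : realType) (n : nat) (pi : 'rV[R]_n).
Hypothesis pi_gt0 : forall i, 0 < pi 0 i.
Hypothesis pi1 : mass pi = 1.
Implicit Types (u v : 'rV[R]_n) (N : 'M[R]_n).

Definition stochastic N := (forall i j, 0 <= N i j) /\ forall i, \sum_j N i j = 1.
Definition l1norm u := \sum_i `|u 0 i|.

Lemma transition_stochastic N : is_transition_matrix N -> stochastic N.
Proof.
move=> tN; split=> [i j|i]; have [h1 h2] := tN i; first by have := h1 j; rewrite mxE.
by rewrite -[RHS]h2; apply: eq_bigr => j _; rewrite mxE.
Qed.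

Lemma stochastic_mass N u : stochastic N -> mass (u *m N) = mass u.
Proof.
move=> [_ N1]; rewrite /mass; under eq_bigr do rewrite mxE.
by rewrite exchange_big; apply: eq_bigr => i _; rewrite -big_distrr /= N1 mulr1.
Qed.

Lemma stochastic_l1norm N u : stochastic N -> l1norm (u *m N) <= l1norm u.
Proof.
move=> [N0 N1]; rewrite /l1norm.
apply: (@le_trans _ _ (\sum_i \sum_j `|u 0 j| * N j i)).
  apply: ler_sum => i _; rewrite mxE; apply: le_trans (ler_norm_sum _ _ _) _.
  by apply: ler_sum => j _; rewrite normrM (ger0_norm (N0 _ _)).
rewrite exchange_big; apply: ler_sum => i _.
by rewrite -big_distrr /= N1 mulr1.
Qed.

Lemma stochastic_exp N k : stochastic N -> stochastic (N ^+ k).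
Proof.
move=> [N0 N1]; elim: k => [|k [IH0 IH1]].
  rewrite expr0; split=> [i j|i]; first by rewrite mxE ler0n.
  rewrite (bigD1 i) //= mxE eqxx big1 ?addr0 // => j ji.
  by rewrite mxE eq_sym (negPf ji).
rewrite exprS; split=> [i j|i]; first by rewrite mxE sumr_ge0 // => l _; rewrite mulr_ge0.
under eq_bigr do rewrite mxE.
rewrite exchange_big -[RHS](N1 i); apply: eq_bigr => l _.
by rewrite -big_distrr /= IH1 mulr1.
Qed.

(** For stationary [pi], the transition matrix of the time-reversed chain; it is the adjoint of [N]
    under the pi-kernel. *)
Definition reversal N : 'M[R]_n := \matrix_(i, j) (pi 0 j * N j i / pi 0 i).

Lemma reversalP N u v : pi_inner pi (u *m N) v = pi_inner pi u (v *m reversal N).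
Proof.
rewrite /pi_inner; under eq_bigr do rewrite mxE !big_distrl /=.
rewrite exchange_big; apply: eq_bigr => i _.
rewrite mxE big_distrr big_distrl; apply: eq_bigr => j _ /=; rewrite mxE.
by field; rewrite !gt_eqF.
Qed.

(** Stationarity is what makes the row sums equal to 1. *)
Lemma reversal_stochastic N : stochastic N -> pi *m N = pi -> stochastic (reversal N).
Proof.
move=> [N0 N1] piN; split=> [i j|i].
  by rewrite mxE mulr_ge0 ?invr_ge0 ?mulr_ge0 ?N0 // ltW.
under eq_bigr do rewrite mxE.
rewrite -big_distrl /= (_ : \sum_j _ = pi 0 i) ?divff ?gt_eqF //.
by rewrite -{2}piN mxE.
Qed.

Lemma stationary_exp N k : pi *m N = pi -> pi *m (N ^+ k) = pi.
Proof.
move=> piN; elim: k => [|k IH]; first by rewrite expr0 mulmx1.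
by rewrite exprS -mulmxE mulmxA piN.
Qed.

(** Cauchy-Schwarz in each column [j], with weights [pi 0 i * N i j] of total [pi 0 j]; summing over
    [j] uses the row sums of [N]. *)
Lemma pi_norm_contract N u : stochastic N -> pi *m N = pi ->
  pi_norm pi (u *m N) <= pi_norm pi u.
Proof.
move=> sN piN; apply: (pi_norm_le pi_gt0); first exact: pi_norm_ge0.
rewrite (pi_norm_sqr pi_gt0); have [N0 N1] := sN.
apply: (@le_trans _ _ (\sum_j \sum_i u 0 i * u 0 i / pi 0 i * N i j)); last first.
  by rewrite exchange_big; apply: ler_sum => i _; rewrite -big_distrr /= N1 mulr1.
apply: ler_sum => j _; rewrite ler_pdivrMr //.
set a := (u *m N) 0 j.
have h s : 0 <= \sum_i (u 0 i - s * pi 0 i) ^+ 2 * N i j / pi 0 i.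
  by apply: sumr_ge0 => i _; rewrite divr_ge0 ?(ltW (pi_gt0 i)) ?(mulr_ge0 (sqr_ge0 _)).
have aE : a = \sum_i u 0 i * N i j by rewrite /a mxE.
have pE : pi 0 j = \sum_i pi 0 i * N i j by rewrite -{1}piN mxE.
have e s : \sum_i (u 0 i - s * pi 0 i) ^+ 2 * N i j / pi 0 i =
    (\sum_i u 0 i * u 0 i / pi 0 i * N i j) - 2 * s * a + s ^+ 2 * pi 0 j.
  rewrite pE aE !big_distrr /= -sumrN -!big_split /=.
  by apply: eq_bigr => i _; field; rewrite gt_eqF.
(* This value of [s] minimizes the quadratic in [e]. *)
have := h (a / pi 0 j); rewrite e.
rewrite -(pmulr_lge0 _ (pi_gt0 j)).
set S := \sum_i _.
suff -> : (S - 2 * (a / pi 0 j) * a + (a / pi 0 j) ^+ 2 * pi 0 j) * pi 0 j =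
  S * pi 0 j - a * a by rewrite subr_ge0.
by field; rewrite gt_eqF.
Qed.

Lemma pi_inner_l1norm u v (c : R) : 0 <= c -> (forall i, `|v 0 i| <= c * pi 0 i) ->
  `|pi_inner pi u v| <= c * l1norm u.
Proof.
move=> c0 vc; apply: le_trans (ler_norm_sum _ _ _) _.
rewrite /l1norm big_distrr; apply: ler_sum => i _ /=.
rewrite !normrM normfV (gtr0_norm (pi_gt0 i)) ler_pdivrMr // mulrC.
rewrite [leRHS]mulrAC; apply: ler_wpM2r => //.
Qed.

(* Replaces the spectral theorem for S = N N~: by Cauchy-Schwarz,
   (<u, u S> / <u, u>)^m <= <u, u S^m> / <u, u> for m = 2^k, while the l1
   contraction gives <u, u S^m> <= C r^m; let m go to infinity. *)
Lemma pi_contraction_of_l1 N (r : R) : stochastic N -> pi *m N = pi -> 0 <= r ->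
  (forall u, mass u = 0 -> l1norm (u *m N) <= r * l1norm u) ->
  forall u, mass u = 0 -> pi_inner pi (u *m N) (u *m N) <= r * pi_inner pi u u.
Proof.
move=> sN piN r0 rN u u0; set N' := reversal N.
have sN' : stochastic N' by exact: reversal_stochastic.
set S := N *m N'.
have SE x : x *m S = x *m N *m N' by rewrite mulmxA.
have adj x y : pi_inner pi (x *m S) y = pi_inner pi x (y *m S).
  by rewrite !SE pi_innerC -reversalP pi_innerC reversalP.
rewrite reversalP -SE.
(* Positivity of [pi] dominates [u] by a multiple of [pi], so inner products with [u] are controlled
   by the l1 norm. *)
have [c [c0 uc]] : exists c, 0 <= c /\ forall i, `|u 0 i| <= c * pi 0 i.
  exists (\sum_i `|u 0 i| / pi 0 i); split.
    by apply: sumr_ge0 => i _; rewrite divr_ge0 // ltW.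
  move=> i; rewrite (bigD1 i) //= mulrDl divfK ?gt_eqF // lerDl mulr_ge0 ?(ltW (pi_gt0 _)) //.
  by apply: sumr_ge0 => j _; rewrite divr_ge0 // ltW.
(* The factor [N] contracts the l1 norm, and [N'] does not increase it. *)
have Sk k : mass (u *m S ^+ k) = 0 /\ l1norm (u *m S ^+ k) <= r ^+ k * l1norm u.
  elim: k => [|k [IH0 IH1]]; first by rewrite !expr0 mulmx1 mul1r.
  rewrite exprSr -mulmxE mulmxA SE; split.
    by rewrite (stochastic_mass _ sN') (stochastic_mass _ sN).
  apply: le_trans (stochastic_l1norm _ sN') _.
  apply: le_trans (rN _ IH0) _; rewrite exprS -mulrA; exact: ler_wpM2l.
have up k : pi_inner pi u (u *m S ^+ k) <= c * l1norm u * r ^+ k.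
  rewrite pi_innerC; apply: le_trans (ler_norm _) _.
  apply: le_trans (pi_inner_l1norm _ c0 uc) _.
  by rewrite -mulrA ler_wpM2l // mulrC; have [] := Sk k.
have adjk k x y : pi_inner pi (x *m S ^+ k) y = pi_inner pi x (y *m S ^+ k).
  elim: k x y => [|k IH] x y; first by rewrite expr0 !mulmx1.
  by rewrite {1}exprSr exprS -!mulmxE (mulmxA x) (mulmxA y) adj IH.
set A := pi_inner pi u u; set B := pi_inner pi u (u *m S).
have A0 : 0 <= A by exact: pi_inner_ge0.
(* Each doubling of the exponent is one Cauchy-Schwarz step, half of the power being moved across by
   self-adjointness. *)
have dbl k : B ^+ (2 ^ k) <= pi_inner pi u (u *m S ^+ (2 ^ k)) * A ^+ (2 ^ k).-1.
  elim: k => [|k IH]; first by rewrite expn0 !expr1 mulr1.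
  have B2 : 0 <= B.
    rewrite /B SE -reversalP; exact: pi_inner_ge0.
  have e : pi_inner pi u (u *m S ^+ (2 ^ k.+1)) =
     pi_inner pi (u *m S ^+ (2 ^ k)) (u *m S ^+ (2 ^ k)).
    by rewrite adjk -mulmxA mulmxE -exprD addnn -mul2n -expnS.
  have l := pi_CauchySchwarz_sqr pi_gt0 u (u *m S ^+ (2 ^ k)).
  rewrite e expnS mulnC exprM.
  have x0 : (0 < 2 ^ k)%N by rewrite expn_gt0.
  have -> : (2 ^ k * 2).-1 = ((2 ^ k).-1 * 2).+1 by rewrite -{1}(prednK x0).
  rewrite [A ^+ _]exprS mulrA [_ * A]mulrC -/A [A ^+ (_ * 2)]exprM.
  apply: le_trans (ler_wpM2r (sqr_ge0 _) l).
  rewrite -exprMn lerXn2r ?nnegrE //; first by rewrite exprn_ge0.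
  by apply: le_trans IH; rewrite exprn_ge0.
have [//|lt] := leP B (r * A).
have [Az|An0] := eqVneq A 0.
  by have := dbl 1%N; rewrite expn1 Az expr1 !mulr0 => B2;
    have := sqr_ge0 B; move: lt; rewrite Az; nra.
have Ap : 0 < A by rewrite lt_neqAle eq_sym An0.
have bnd k : B ^+ (2 ^ k) * A <= c * l1norm u * (r * A) ^+ (2 ^ k).
  have x0 : (0 < 2 ^ k)%N by rewrite expn_gt0.
  rewrite exprMn -{3}(prednK x0) exprSr [leRHS]mulrA [leRHS]mulrA.
  apply: (ler_wpM2r A0); apply: le_trans (dbl k) _.
  by apply: ler_wpM2r; [exact: exprn_ge0|exact: up].
have B0 : 0 < B by apply: le_lt_trans lt; rewrite mulr_ge0.
have [r0'|rn0] := eqVneq r 0.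
  by have := bnd 0%N; rewrite r0' mul0r expn0 !expr1 mulr0 => h; have := mulr_gt0 B0 Ap; lra.
have rA : 0 < r * A by rewrite mulr_gt0 // lt_neqAle eq_sym rn0.
(* [1 + h] is the ratio of [B] to [r * A]; by Bernoulli's inequality its powers are unbounded,
   against [bnd]. *)
set h := B / (r * A) - 1.
have hp : 0 < h by rewrite subr_gt0 ltr_pdivlMr // mul1r.
have Bh : B = (1 + h) * (r * A) by rewrite /h addrC subrK divfK ?gt_eqF.
set D := c * l1norm u.
have unb k : (1 + h *+ (2 ^ k)) * A <= D.
  have := bnd k; rewrite Bh exprMn mulrAC ler_pM2r ?exprn_gt0 // => b.
  apply: le_trans b; apply: ler_wpM2r => //.
  elim: (2 ^ k)%N => [|m IH]; first by rewrite mulr0n addr0 expr0.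
  rewrite exprS; have := ler_wpM2l (ltW (ltr_wpDr (ltW hp) (@ltr01 R))) IH.
  apply: le_trans; rewrite mulrS.
  have : 0 <= h *+ m by rewrite mulrn_wge0 // ltW.
  by nra.
(* Chosen so that [k.+1 * (h * A)] already exceeds [D], while [2 ^ k.+1] is larger than [k.+1]. *)
set k := Num.truncn (D / (h * A)).
have : D / (h * A) < k.+1%:R.
  by rewrite truncnS_gt.
rewrite ltr_pdivrMr ?mulr_gt0 // => hk.
have := unb k.+1; have : k.+1%:R * h <= h *+ 2 ^ k.+1.
  by rewrite -[leRHS]mulr_natl; apply: ler_wpM2r; rewrite ?(ltW hp) // ler_nat ltnW // ltn_expl.
move=> /(ler_wpM2r A0) h1 h2; suff : D < D by rewrite ltxx.
apply: (lt_le_trans hk); rewrite mulrA; apply: le_trans h1 (le_trans _ h2).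
by rewrite mulrDl mul1r lerDr.
Qed.

(** Equal masses make the positive and negative parts of [u - v] equally large, and [A] collects the
    positive part. *)
Lemma l1_le_tv u v : mass u = mass v -> l1norm (u - v) <= 2 * tv_dist u v.
Proof.
move=> uv; set A := [set i : 'I_n | v 0 i <= u 0 i]%SET.
have m1 : \sum_(i in A) u 0 i - \sum_(i in A) v 0 i <= tv_dist u v.
  apply: le_trans (ler_norm _) _.
  by rewrite /tv_dist (bigmax_sup A).
have -> : l1norm (u - v) = 2 * (\sum_(i in A) u 0 i - \sum_(i in A) v 0 i).
  move: uv; rewrite /mass (bigID (mem A)) [in RHS](bigID (mem A)) /= => uv.
  rewrite /l1norm (bigID (mem A)) /=.
  rewrite (_ : \sum_(i in A) `|_| = \sum_(i in A) u 0 i - \sum_(i in A) v 0 i); last first.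
    rewrite -sumrB; apply: eq_bigr => i; rewrite inE !mxE => h.
    by rewrite ger0_norm // subr_ge0.
  rewrite (_ : \sum_(i | i \notin A) `|_| =
      \sum_(i | i \notin A) v 0 i - \sum_(i | i \notin A) u 0 i); last first.
    rewrite -sumrB; apply: eq_bigr => i; rewrite inE -ltNge !mxE => h.
    by rewrite ltr0_norm ?subr_lt0 // opprB.
  lra.
by rewrite ler_pM2l.
Qed.

(** Since [u] has mass 0, [pi] may be subtracted from every row of [N ^+ k], and each row is within
    [2 * eps] of [pi] in l1. *)
Lemma mixed_l1_contraction N eps k : stochastic N -> mixed_at N pi eps k ->
  forall u, mass u = 0 -> l1norm (u *m N ^+ k) <= 2 * eps * l1norm u.
Proof.
move=> sN mix u u0; have [N0 N1] := stochastic_exp k sN.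
have -> : u *m N ^+ k = \row_j \sum_i u 0 i * ((N ^+ k) i j - pi 0 j).
  apply/rowP => j; rewrite !mxE; under [RHS]eq_bigr do rewrite mulrBr.
  by rewrite sumrB -big_distrl /= -/(mass u) u0 mul0r subr0.
apply: (@le_trans _ _ (\sum_i `|u 0 i| * l1norm (row i (N ^+ k) - pi))).
  under [leRHS]eq_bigr do rewrite big_distrr.
  rewrite exchange_big; apply: ler_sum => j _ /=; rewrite mxE.
  apply: le_trans (ler_norm_sum _ _ _) _; apply: ler_sum => i _.
  by rewrite normrM !mxE.
rewrite mulrC /l1norm big_distrl; apply: ler_sum => i _ /=.
apply: ler_wpM2l => //; rewrite -/(l1norm (row i (N ^+ k) - pi)).
have mr : mass (row i (N ^+ k)) = 1.
  by rewrite -[RHS](N1 i); apply: eq_bigr => j _; rewrite mxE.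
apply: le_trans (l1_le_tv _) _; first by rewrite mr pi1.
(* Row [i] is the law after [k] steps from the point mass at [i]. *)
rewrite ler_pM2l // rowE; apply: mix; split=> [j|].
  by rewrite mxE ler0n.
rewrite (bigD1 i) //= big1 ?addr0 ?mxE ?eqxx // => j ji.
by rewrite mxE (negPf ji) andbF.
Qed.

Lemma mixed_pi_contraction N eps k : stochastic N -> pi *m N = pi ->
  0 <= eps -> eps <= 1 / 8 -> mixed_at N pi eps k ->
  forall u, mass u = 0 -> 2 * pi_norm pi (u *m N ^+ k) <= pi_norm pi u.
Proof.
move=> sN piN e0 e1 mix u u0.
have := pi_contraction_of_l1 (stochastic_exp k sN) (stationary_exp k piN)
  (mulr_ge0 (ler0n R 2) e0) (mixed_l1_contraction sN mix) u0.
move=> h; rewrite -ler_pdivlMl // mulrC; apply: pi_norm_le => //.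
  by rewrite divr_ge0 ?pi_norm_ge0.
rewrite exprMn pi_norm_sqr //; apply: le_trans h _.
by have := pi_inner_ge0 pi_gt0 u; nra.
Qed.

End Chain.

(** Some state carries mass; irreducibility sends part of it to [j] in [k] steps, and [pi] is
    invariant under [M ^+ k]. *)
Lemma stationary_gt0 (R : realType) n (M : 'M[R]_n) (pi : 'rV[R]_n) :
  is_transition_matrix M -> is_irreducible M -> is_stationary M pi ->
  forall i, 0 < pi 0 i.
Proof.
move=> /transition_stochastic sM irr [[p0 p1] piM] j.
have [i pi0] : exists i, 0 < pi 0 i.
  apply/not_existsP => h.
  have : \sum_i pi 0 i <= 0.
    by apply: sumr_le0 => i _; rewrite leNgt; apply/negP/h.
  by rewrite p1 ler10.
have [k Mk] := irr i j; have [M0 _] := stochastic_exp k sM.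
rewrite -(stationary_exp k piM) mxE (bigD1 i) //= ltr_pwDl ?mulr_gt0 //.
by apply: sumr_ge0 => l _; rewrite mulr_ge0.
Qed.

(** * Weighted path sums as products of transfer matrices *)

Section Transfer.
Variables (R : realType) (n : nat) (pi : 'rV[R]_n) (M : 'M[R]_n).
Hypothesis pi_gt0 : forall i, 0 < pi 0 i.
Hypothesis pi1 : mass pi = 1.
Hypothesis sM : stochastic M.
Hypothesis piM : pi *m M = pi.

(** For an initial distribution [z], the expected product of the weights [w i] at the first [k]
    states. The move after the last reweighting keeps the mass. *)
Fixpoint transfer k (z : 'rV[R]_n) (w : nat -> 'I_n -> R) : R :=
  if k is k'.+1 then transfer k' (reweight (w 0%N) z *m M) (fun i => w i.+1)
  else mass z.

Lemma fluct_mul z : fluct pi (z *m M) = fluct pi z *m M.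
Proof. by rewrite /fluct stochastic_mass // mulmxBl -scalemxAl piM. Qed.

Lemma reweight1 (z : 'rV[R]_n) : reweight (fun _ => 1 : R) z = z.
Proof. by apply/rowP => i; rewrite mxE mulr1. Qed.

(** The constant 1 is neutral in the product, so only times congruent to [h] modulo [T] count. *)
Definition sparse (T h : nat) (g : nat -> 'I_n -> R) i : 'I_n -> R :=
  if (i %% T == h)%N then g i else fun _ => 1.

Lemma dvdnS_modn m d : (0 < d)%N -> (d %| m.+1)%N = ((m %% d).+1 == d).
Proof.
move=> d0; rewrite {1}(divn_eq m d) -addnS dvdn_addr ?dvdn_mull //.
apply/idP/eqP => [/dvdn_leq le|->//].
by apply/eqP; rewrite eqn_leq ltn_pmod //= le.
Qed.

Lemma sparse_shift T h g : (h.+1 < T)%N ->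
  (fun i => sparse T h.+1 g i.+1) = sparse T h (fun i => g i.+1).
Proof.
move=> hT; apply/funext => i; rewrite /sparse; congr (if _ then _ else _).
rewrite modnS dvdnS_modn ?(leq_trans _ hT) //; move: (i %% T)%N => r.
case: (r.+1 =P T) => [e|_]; last by rewrite eqSS.
by apply/esym/eqP => rh; move: hT; rewrite -e rh ltnn.
Qed.

Lemma sparse_wrap T g :
  (fun i => sparse T.+1 0 g i.+1) = sparse T.+1 T (fun i => g i.+1).
Proof.
apply/funext => i; rewrite /sparse; congr (if _ then _ else _).
by rewrite modnS dvdnS_modn // eqSS; case: (_ %% _ == T)%N.
Qed.

(* [h] counts the steps left before the next nontrivial reweighting; measuring
   the fluctuation after [h] more steps lets it be halved exactly when a full
   period has elapsed. *)
Lemma transfer_sparse_le T (b G : R) k h (z : 'rV[R]_n) (g : nat -> 'I_n -> R) :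
  (h <= T)%N -> 0 <= b -> 0 <= G ->
  (forall u, mass u = 0 -> 2 * pi_norm pi (u *m M ^+ T.+1) <= pi_norm pi u) ->
  (forall i x, `|mass (reweight (g i) x)| + 2 * b * pi_norm pi (fluct pi (reweight (g i) x)) <=
     G * (`|mass x| + 4 * b * pi_norm pi (fluct pi x))) ->
  transfer k z (sparse T.+1 h g) <=
    G ^+ ((k + T - h) %/ T.+1) * (`|mass z| + 4 * b * pi_norm pi (fluct pi z *m M ^+ h)).
Proof.
move=> hT b0 G0 ctr; elim: k h z g hT => [|k IH] [|h] z g hT step /=.
(* The exponent of [G] counts the [i < k] congruent to [h] modulo [T.+1]; there are none for
   [k = 0]. *)
- rewrite divn_small; last by lia.
  rewrite mul1r; apply: le_trans (ler_norm _) _.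
  by rewrite lerDl !mulr_ge0 ?pi_norm_ge0.
- rewrite divn_small; last by lia.
  rewrite mul1r; apply: le_trans (ler_norm _) _.
  by rewrite lerDl !mulr_ge0 ?pi_norm_ge0.
(* A weight is collected now and the next one comes a full period later, so [ctr] turns the
   coefficient [4 * b] into the [2 * b] of [step]. *)
- rewrite sparse_wrap; apply: le_trans (IH _ _ _ (leqnn T) _) _.
    by move=> i; exact: step.
  rewrite stochastic_mass // fluct_mul -mulmxA mulmxE -exprS expr0 mulmx1.
  have -> : ((k.+1 + T - 0) %/ T.+1 = ((k + T - T) %/ T.+1).+1)%N.
    by rewrite subn0 addnK addSnnS divnDr ?dvdnn // divnn addn1.
  rewrite [G ^+ _.+1]exprSr -[leRHS]mulrA; apply: ler_wpM2l; first exact: exprn_ge0.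
  apply: le_trans (step 0%N z); rewrite /sparse mod0n eqxx lerD2l.
  have := ctr _ (mass_fluct pi1 (reweight (g 0%N) z)) => /(ler_wpM2l b0) h1; lra.
- rewrite sparse_shift //; apply: le_trans (IH _ _ _ (ltnW hT) _) _.
    by move=> i; exact: step.
  rewrite /sparse mod0n /= reweight1 stochastic_mass // fluct_mul -mulmxA mulmxE -exprS.
  by rewrite addSn subSS.
Qed.

Definition path_weight k (z : 'rV[R]_n) (v : {ffun 'I_k.+1 -> 'I_n}) : R :=
  z 0 (v ord0) * \prod_(i < k) M (v (widen_ord (leqnSn k) i)) (v (lift ord0 i)).

Lemma path_weight_ge0 k (z : 'rV[R]_n) (v : {ffun 'I_k.+1 -> 'I_n}) :
  (forall i, 0 <= z 0 i) -> 0 <= path_weight z v.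
Proof. by have [M0 _] := sM; move=> z0; rewrite mulr_ge0 ?prodr_ge0. Qed.

Definition ffun_cons (A : Type) k (x : A) (v : {ffun 'I_k -> A}) : {ffun 'I_k.+1 -> A} :=
  [ffun i => oapp v x (unlift ord0 i)].

Lemma ffun_cons0 A k x (v : {ffun 'I_k -> A}) : ffun_cons x v ord0 = x.
Proof. by rewrite ffunE unlift_none. Qed.

Lemma ffun_consS A k x (v : {ffun 'I_k -> A}) i : ffun_cons x v (lift ord0 i) = v i.
Proof. by rewrite ffunE liftK. Qed.

Lemma big_ffun_cons (A : finType) k (F : {ffun 'I_k.+1 -> A} -> R) :
  \sum_v F v = \sum_x \sum_v F (ffun_cons x v).
Proof.
rewrite pair_bigA (reindex (fun p : A * {ffun 'I_k -> A} => ffun_cons p.1 p.2)) //=.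
exists (fun v => (v ord0, [ffun i => v (lift ord0 i)])) => [[x v]|v] _ /=.
  by rewrite ffun_cons0; congr (_, _); apply/ffunP => i; rewrite ffunE ffun_consS.
apply/ffunP => i; rewrite ffunE; case: unliftP => [j ->|->] //=.
by rewrite ffunE.
Qed.

(** Summing out the first state leaves a shorter path with initial vector [reweight (w 0%N) z *m M];
    hence the induction over all [z]. *)
Lemma sum_path_transfer k (z : 'rV[R]_n) (w : nat -> 'I_n -> R) :
  \sum_(v : {ffun 'I_k.+1 -> 'I_n}) path_weight z v * \prod_(i < k.+1) w i (v i) =
  transfer k.+1 z w.
Proof.
elim: k z w => [|k IH] z w.
  rewrite big_ffun_cons /= stochastic_mass //; apply: eq_bigr => x _.
  rewrite (big_pred1 [ffun=> x]); last first.
    by move=> v; apply/esym/eqP/ffunP => -[].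
  by rewrite /path_weight big_ord0 big_ord_recl big_ord0 ffun_cons0 !mulr1 mxE.
rewrite big_ffun_cons exchange_big -[RHS]/(transfer k.+1 _ (fun i => w i.+1)) -IH.
apply: eq_bigr => v _.
rewrite /path_weight mxE !big_distrl; apply: eq_bigr => x _ /=.
rewrite big_ord_recl [in X in _ * X = _]big_ord_recl.
have -> : widen_ord (leqnSn k.+1) ord0 = ord0 by apply/val_inj.
rewrite !ffun_cons0 ffun_consS mxE.
under [X in _ * (_ * X) * _ = _]eq_bigr => i _.
  rewrite (_ : widen_ord _ (lift ord0 i) =
    lift ord0 (widen_ord (leqnSn k) i)); last exact/val_inj.
  rewrite !ffun_consS; over.
under [X in _ * (_ * _) * (_ * X) = _]eq_bigr => i _ do rewrite ffun_consS /=.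
by rewrite /=; ring.
Qed.

End Transfer.

(** * Elementary bounds for the exponential *)

Section ExpBounds.
Variable R : realType.
Implicit Types x s : R.

(** From [expR x * (1 - x) <= expR x * expR (- x) = 1], and [(1 + x + 2 * x ^+ 2) * (1 - x) >= 1] on
    this range. *)
Lemma expR_small x : `|x| <= 1 / 18 ->
  [/\ expR x <= 1 + x + 2 * x ^+ 2, `|expR x - 1| <= 2 * `|x| & expR x <= 10 / 9].
Proof.
move=> x18; have := x18; rewrite ler_norml => /andP[h1 h2].
have q : x ^+ 2 <= 1 / 18 * `|x|.
  by rewrite -[_ ^+ _]ger0_norm ?sqr_ge0 // normrX expr2 ler_wpM2r.
have := ler_norm x; have := ler_norm (- x); rewrite normrN => n1 n2.
have n0 := normr_ge0 x.
have e1 := expR_ge1Dx x; have e2 := expR_ge1Dx (- x).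
have e3 : expR x * expR (- x) = 1 by rewrite -expRD subrr expR0.
have e4 : expR x * (1 - x) <= 1 by rewrite -[leRHS]e3 ler_pM2l ?expR_gt0.
have A : expR x <= 1 + x + 2 * x ^+ 2.
  rewrite -(ler_pM2r (_ : 0 < 1 - x)); last by lra.
  by apply: le_trans e4 _; nra.
split=> //; last by lra.
by rewrite ler_norml; apply/andP; split; lra.
Qed.

(** Jensen's inequality: sum the tangent-line bounds at the mean [m], whose linear terms cancel. *)
Lemma expR_mean_le T (y : 'I_T.+1 -> R) :
  expR (T.+1%:R^-1 * \sum_h y h) <= T.+1%:R^-1 * \sum_h expR (y h).
Proof.
set m := _ * _; have T0 : (T.+1%:R : R) != 0 by rewrite pnatr_eq0.
rewrite -(ler_pM2l (_ : 0 < T.+1%:R)) ?ltr0n // mulrA divff // mul1r.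
apply: (@le_trans _ _ (\sum_h expR m * (1 + (y h - m)))); last first.
  apply: ler_sum => h _; rewrite -[in leRHS](subrK m (y h)) [in leRHS]addrC expRD.
  by rewrite ler_pM2l ?expR_gt0 // expR_ge1Dx.
rewrite -big_distrr /= big_split sumrB /= !big_const_ord !iter_addr_0.
by rewrite -[m *+ _]mulr_natl /m mulrA divff // mul1r subrr addr0 mulrC.
Qed.
End ExpBounds.

(** * The exponential moment of the total weight *)

Section ExponentialMoment.
Variables (R : realType) (n : nat) (pi : 'rV[R]_n) (M : 'M[R]_n).
Hypothesis pi_gt0 : forall i, 0 < pi 0 i.
Hypothesis pi1 : mass pi = 1.

Section OneStep.
Variables (g : 'I_n -> R) (mu s : R).
Hypothesis g01 : forall i, 0 <= g i <= 1.
Hypothesis gmu : mean pi g = mu.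
Hypothesis s18 : `|s| <= 1 / 18.

Lemma mean_ge0_le1 : 0 <= mu <= 1.
Proof.
rewrite -gmu /mean; apply/andP; split.
  by apply: sumr_ge0 => i _; rewrite mulr_ge0 ?(ltW (pi_gt0 i)) //; have /andP[] := g01 i.
rewrite -[leRHS]pi1; apply: ler_sum => i _.
by rewrite ler_piMr ?(ltW (pi_gt0 i)) //; have /andP[] := g01 i.
Qed.

(** The value of [b] comes from [|expR (s * g i) - 1| <= 2 * |s| * g i] and [g i ^+ 2 <= g i]. Then
    [2 * b ^+ 2 = 8 * s ^+ 2 * mu] is added to the mass bound [1 + s * mu + 2 * s ^+ 2 * mu]. *)
Lemma potential_expR z :
  `|mass (reweight (fun i => expR (s * g i)) z)| +
    2 * (2 * `|s| * Num.sqrt mu) *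
      pi_norm pi (fluct pi (reweight (fun i => expR (s * g i)) z)) <=
  (1 + s * mu + 10 * s ^+ 2 * mu) *
    (`|mass z| + 4 * (2 * `|s| * Num.sqrt mu) * pi_norm pi (fluct pi z)).
Proof.
have /andP[mu0 mu1] := mean_ge0_le1.
have sg i : `|s * g i| <= 1 / 18.
  have /andP[g0 g1] := g01 i.
  by rewrite normrM (ger0_norm g0); apply: le_trans s18; rewrite ler_piMr.
have g2 i : g i ^+ 2 <= g i.
  by have /andP[g0 g1] := g01 i; rewrite expr2 ler_piMr.
have b2 : (2 * `|s| * Num.sqrt mu) ^+ 2 = 4 * s ^+ 2 * mu.
  by rewrite !exprMn sqr_sqrtr // -normrX ger0_norm ?sqr_ge0 //; ring.
have s2 : s ^+ 2 <= 1 / 18 * (1 / 18).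
  by rewrite -[_ ^+ _]ger0_norm ?sqr_ge0 // normrX expr2 ler_pM.
have sm : - (1 / 18) <= s * mu.
  suff : `|s * mu| <= 1 / 18 by rewrite ler_norml => /andP[].
  by rewrite normrM (ger0_norm mu0); apply: le_trans s18; rewrite ler_piMr.
have sm2 : 0 <= s ^+ 2 * mu by rewrite mulr_ge0 ?sqr_ge0.
apply: (@potential_reweight R n pi pi_gt0 pi1 _ (1 + s * mu + 2 * s ^+ 2 * mu) _ (10 / 9)).
- by rewrite !mulr_ge0 ?sqrtr_ge0.
- by lra.
- by move=> i; rewrite ger0_norm ?expR_ge0 //; have [] := expR_small (sg i).
- rewrite ger0_norm; last first.
    by apply: sumr_ge0 => i _; rewrite mxE mulr_ge0 ?expR_ge0 ?(ltW (pi_gt0 i)).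
  rewrite -{1}pi1 -gmu /mass /mean !big_distrr -!big_split /=.
  apply: ler_sum => i _; rewrite mxE.
  have -> : pi 0 i + s * (pi 0 i * g i) + 2 * s ^+ 2 * (pi 0 i * g i) =
    pi 0 i * (1 + s * g i + 2 * (s ^+ 2 * g i)) by ring.
  apply: ler_wpM2l; first exact: ltW.
  have [e _ _] := expR_small (sg i); apply: le_trans e _.
  by rewrite lerD2l ler_pM2l // exprMn ler_wpM2l ?sqr_ge0.
- apply: (pi_norm_le pi_gt0); first by rewrite !mulr_ge0 ?sqrtr_ge0.
  rewrite b2 -gmu /mean big_distrr /=; apply: ler_sum => i _; rewrite !mxE.
  have -> : pi 0 i * (expR (s * g i) - 1) * (pi 0 i * (expR (s * g i) - 1)) / pi 0 i =
     pi 0 i * (expR (s * g i) - 1) ^+ 2 by field; rewrite gt_eqF.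
  rewrite [leRHS]mulrCA; apply: ler_wpM2l; first exact: ltW.
  have [_ e _] := expR_small (sg i).
  rewrite -[leLHS]ger0_norm ?sqr_ge0 // normrX.
  apply: (@le_trans _ _ ((2 * `|s * g i|) ^+ 2)).
    by rewrite lerXn2r ?nnegrE ?mulr_ge0.
  rewrite exprMn -normrX ger0_norm ?sqr_ge0 // exprMn mulrA.
  have -> : (2 : R) ^+ 2 = 4 by ring.
  by rewrite ler_wpM2l // mulr_ge0 ?sqr_ge0.
- rewrite b2; lra.
(* [1 + 2 * (10 / 9) = 29 / 9] is below [4 * (1 - 1 / 18) = 34 / 9]. *)
- lra.
Qed.

End OneStep.

Hypothesis sM : stochastic M.
Hypothesis piM : pi *m M = pi.

(** The factor 2 bounds the initial potential by the pi-norm of [z]; [expR 1] absorbs the rounding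
    of [k.+1 / T.+1] to the number of collected weights. *)
Lemma exponential_moment T k (z : 'rV[R]_n) (f : 'I_k.+1 -> 'I_n -> R) (mu s : R) :
  (forall i v, 0 <= f i v <= 1) -> (forall i, mean pi (f i) = mu) ->
  `|s| <= 1 / 18 -> is_distribution z ->
  (forall u, mass u = 0 -> 2 * pi_norm pi (u *m M ^+ T.+1) <= pi_norm pi u) ->
  \sum_(v : {ffun 'I_k.+1 -> 'I_n})
     path_weight M z v * expR (s / T.+1%:R * \sum_i f i (v i)) <=
  2 * expR 1 * pi_norm pi z *
    expR (k.+1%:R / T.+1%:R * (s * mu + 10 * s ^+ 2 * mu)).
Proof.
move=> f01 fmu s18 [z0 z1] ctr.
have /andP[mu0 mu1] := mean_ge0_le1 (f01 ord0) (fmu ord0).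
(* [inord] extends [f] to all natural times; only times up to [k] enter. *)
pose g (i : nat) x := expR (s * f (inord i) x).
set L := s * mu + 10 * s ^+ 2 * mu; set K := _ * expR (_ * L).
have s2 : s ^+ 2 <= 1 / 18 * (1 / 18).
  by rewrite -[_ ^+ _]ger0_norm ?sqr_ge0 // normrX expr2 ler_pM.
have sm : `|s * mu| <= 1 / 18.
  by rewrite normrM (ger0_norm mu0); apply: le_trans s18; rewrite ler_piMr.
have sm2 : 0 <= s ^+ 2 * mu <= 1 / 18 * (1 / 18).
  by rewrite mulr_ge0 ?sqr_ge0 //=; apply: le_trans s2; rewrite ler_piMr ?sqr_ge0.
have L1 : `|L| <= 1.
  by move: sm sm2; rewrite !ler_norml /L => /andP[? ?] /andP[? ?]; apply/andP; split; lra.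
have nz : 1 <= pi_norm pi z.
  by apply: le_trans (mass_le_norm pi_gt0 pi1 z); rewrite /mass z1 normr1.
have one (h : nat) : (h <= T)%N -> transfer M k.+1 z (sparse T.+1 h g) <= K.
  move=> hT; set b := 2 * `|s| * Num.sqrt mu.
  have b0 : 0 <= b by rewrite !mulr_ge0 ?sqrtr_ge0.
  have b1 : 4 * b <= 1.
    have q1 : Num.sqrt mu <= 1 by rewrite -(sqrtr1 R) ler_wsqrtr.
    have : `|s| * Num.sqrt mu <= 1 / 18.
      by apply: le_trans s18; rewrite ler_piMr.
    rewrite /b; lra.
  have G0 : 0 <= 1 + s * mu + 10 * s ^+ 2 * mu.
    by move: L1; rewrite ler_norml /L => /andP[? ?]; lra.
  have := @transfer_sparse_le R n pi M pi1 sM piM T b _ k.+1 h z g hT b0 G0 ctr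
    (fun i => potential_expR (f01 (inord i)) (fmu (inord i)) s18).
  rewrite -/g => /le_trans; apply; set m := (_ %/ _)%N.
  have GL : (1 + s * mu + 10 * s ^+ 2 * mu) ^+ m <= expR 1 * expR (k.+1%:R / T.+1%:R * L).
    apply: (@le_trans _ _ (expR L ^+ m)).
      by rewrite lerXn2r ?nnegrE ?expR_ge0 // -addrA expR_ge1Dx.
    rewrite -expRM_natl -expRD ler_expR.
    (* As [h <= T], rounding costs at most 1; with [|L| <= 1] the exponent moves by at most 1. *)
    have dm : `|m%:R - k.+1%:R / T.+1%:R| <= 1 :> R.
      have T0 : (0 : R) < T.+1%:R by rewrite ltr0n.
      have e1 : (m * T.+1 <= k.+1 + T - h)%N by rewrite leq_divM.
      have e2 : (k.+1 + T - h < m.+1 * T.+1)%N by rewrite ltn_ceil.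
      have e3 : (m * T.+1 <= k.+1 + T.+1)%N.
        by apply: leq_trans e1 (leq_trans (leq_subr _ _) _); rewrite leq_add2l.
      have e4 : (k.+1 <= (m + 1) * T.+1)%N.
        by rewrite addn1; apply: leq_trans (ltnW e2); rewrite -addnBA // leq_addr.
      rewrite ler_norml lerBlDr lerBrDr; apply/andP; split.
        by rewrite addrC lerBlDr ler_pdivrMr // natr1 -natrM ler_nat -(addn1 m).
      by rewrite -lerBlDl ler_pdivlMr // mulrBl mul1r lerBlDr -natrM -natrD ler_nat.
    have : `|(m%:R - k.+1%:R / T.+1%:R) * L| <= 1.
      by rewrite normrM -[leRHS]mulr1 ler_pM.
    by rewrite mulrBl ler_norml lerBlDr => /andP[_].
  (* The mass 1 is at most the norm of [z], and so is the other term because [4 * b <= 1]. *)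
  have ph : `|mass z| + 4 * b * pi_norm pi (fluct pi z *m M ^+ h) <= 2 * pi_norm pi z.
    rewrite /mass z1 normr1.
    have c1 := pi_norm_contract pi_gt0 (fluct pi z)
      (stochastic_exp h sM) (stationary_exp h piM).
    have c2 := le_trans c1 (pi_norm_fluct pi_gt0 pi1 z).
    have := ler_pM (mulr_ge0 (ler0n _ 4) b0) (pi_norm_ge0 _ _) b1 c2.
    by rewrite mul1r; lra.
  apply: le_trans (ler_pM (exprn_ge0 _ G0) _ GL ph) _.
    by rewrite addr_ge0 ?mulr_ge0 ?pi_norm_ge0.
  rewrite le_eqVlt; apply/orP; left; apply/eqP; rewrite /K; ring.
apply: (@le_trans _ _ (T.+1%:R^-1 * \sum_(h < T.+1) K)); last first.
  by rewrite big_const_ord iter_addr_0 -[K *+ _]mulr_natl mulrA mulVf ?mul1r // pnatr_eq0.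
apply: (@le_trans _ _ (T.+1%:R^-1 *
    \sum_(h < T.+1) transfer M k.+1 z (sparse T.+1 h g))); last first.
  by rewrite ler_pM2l ?invr_gt0 ?ltr0n //; apply: ler_sum => h _; rewrite one // -ltnS.
under [in leRHS]eq_bigr do rewrite -sum_path_transfer //.
rewrite exchange_big big_distrr; apply: ler_sum => v _ /=.
rewrite -big_distrr mulrCA /=; apply: ler_wpM2l; first exact: path_weight_ge0.
(* Each time lies in exactly one residue class, so the exponent is an average of class sums, ready
   for Jensen. *)
have -> : s / T.+1%:R * \sum_i f i (v i) =
   T.+1%:R^-1 * \sum_(h < T.+1) \sum_(i < k.+1)
     (if (i %% T.+1 == h)%N then s * f i (v i) else 0).
  rewrite exchange_big mulrAC mulrC; congr (_ * _).
  rewrite big_distrr; apply: eq_bigr => i _ /=.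
  have lt : (i %% T.+1 < T.+1)%N by rewrite ltn_pmod.
  rewrite (bigD1 (Ordinal lt)) //= eqxx big1 ?addr0 // => h hi.
  case: eqP => // e; case/eqP: hi; exact/val_inj.
apply: le_trans (expR_mean_le _) _; rewrite ler_pM2l ?invr_gt0 ?ltr0n //.
apply: ler_sum => h _; rewrite expR_sum le_eqVlt; apply/orP; left; apply/eqP.
apply: eq_bigr => i _; rewrite /sparse /g; case: ifP => _; last exact: expR0.
by rewrite inord_val.
Qed.

End ExponentialMoment.

(** * The law of the walk and Markov's inequality *)

Section Walk.
Variables (R : realType) (n k : nat) (M : 'M[R]_n) (phi : 'rV[R]_n).
Variables (d : measure_display) (Omega : measurableType d) (P : probability Omega R).
Variable V : 'I_k.+1 -> Omega -> 'I_n.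
Hypothesis walk : is_random_walk P M phi V.

Lemma walk_prefix_prob (j : nat) (v : 'I_k.+1 -> 'I_n) : (j <= k)%N ->
  P [set w | forall i : 'I_k.+1, (i <= j)%N -> V i w = v i] =
  (phi 0 (v ord0) * \prod_(i < k | (i < j)%N)
     M (v (widen_ord (leqnSn k) i)) (v (lift ord0 i)))%:E.
Proof.
have [_ ini mar] := walk; elim: j => [_|j IH jk].
  rewrite big_pred0 // mulr1 -(ini ord0) //; congr (P _); apply/seteqP; split=> w /=.
    by move=> h; exact: h.
  by move=> h i; rewrite leqn0 => /eqP i0; rewrite (_ : i = ord0) //; exact: val_inj.
have e : \prod_(i < k | (i < j.+1)%N) M (v (widen_ord (leqnSn k) i)) (v (lift ord0 i)) =
    (\prod_(i < k | (i < j)%N) M (v (widen_ord (leqnSn k) i)) (v (lift ord0 i))) *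
    M (v (widen_ord (leqnSn k) (Ordinal jk))) (v (lift ord0 (Ordinal jk))).
  rewrite (bigD1 (Ordinal jk)) //= mulrC; congr (_ * _); apply: eq_bigl => i.
  by rewrite ltnS ltn_neqAle andbC.
rewrite e mulrA EFinM -(IH (ltnW jk)).
exact: (mar (widen_ord (leqnSn k) (Ordinal jk)) (lift ord0 (Ordinal jk))).
Qed.

Lemma walk_path_prob (v : {ffun 'I_k.+1 -> 'I_n}) :
  P [set w | forall i, V i w = v i] = (path_weight M phi v)%:E.
Proof.
rewrite /path_weight.
have := walk_prefix_prob v (leqnn k).
rewrite (eq_bigl xpredT); last by move=> i; rewrite ltn_ord.
move=> <-; congr (P _); apply/seteqP; split=> w /= h i; first by move=> _; exact: h.
by apply: h; rewrite -ltnS.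
Qed.

(** The event is the finite union of the path events [F v] with [B v]; subadditivity gives the
    bound. *)
Lemma walk_event_le (B : pred {ffun 'I_k.+1 -> 'I_n}) :
  (P [set w | B [ffun i => V i w]] <=
   (\sum_(v | B v) path_weight M phi v)%:E)%E.
Proof.
have [mV _ _] := walk.
pose F (v : {ffun 'I_k.+1 -> 'I_n}) := [set w | forall i, V i w = v i].
have mF v : measurable (F v).
  rewrite (_ : F v = \bigcap_(i in [set: 'I_k.+1]) (V i @^-1` [set v i])).
    by apply: fin_bigcap_measurable => //= i _; exact: mV.
  by apply/seteqP; split=> w h; [move=> i _; exact: h|move=> i; exact: h].
have E : [set w | B [ffun i => V i w]] = \bigcup_(v in [set` B]) F v.
  apply/seteqP; split=> w /=.
    by move=> Bw; exists [ffun i => V i w] => //= i; rewrite ffunE.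
  move=> [v /= Bv Fv]; rewrite (_ : [ffun i => V i w] = v) //.
  by apply/ffunP => i; rewrite ffunE.
have finB : finite_set [set` B] by exact: finite_finset.
apply: le_trans (content_sub_fsum (D := [set` B]) P finB (fun v _ => mF v) _ _) _.
- by rewrite E; exact: fin_bigcup_measurable.
- by rewrite E.
rewrite -(bigfs _ (r := index_enum _)) ?index_enum_uniq //; last first.
  by move=> v _; rewrite mem_index_enum.
rewrite -sumEFin; apply: lee_sum => v _; by rewrite -walk_path_prob.
Qed.

(** Markov's inequality: [expR (X v) >= 1] on [B], and the remaining terms are nonnegative. *)
Lemma walk_markov (X : {ffun 'I_k.+1 -> 'I_n} -> R)
    (B : pred {ffun 'I_k.+1 -> 'I_n}) :
  stochastic M -> is_distribution phi -> (forall v, B v -> 0 <= X v) ->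
  (P [set w | B [ffun i => V i w]] <=
   (\sum_v path_weight M phi v * expR (X v))%:E)%E.
Proof.
move=> sM [phi0 _] BX; apply: le_trans (walk_event_le B) _.
rewrite lee_fin [leRHS](bigID B) /= -[leLHS]addr0; apply: lerD.
  apply: ler_sum => v /BX X0; rewrite ler_peMr ?path_weight_ge0 //.
  by rewrite -expR0 ler_expR.
by apply: sumr_ge0 => v _; rewrite mulr_ge0 ?expR_ge0 ?path_weight_ge0.
Qed.

End Walk.

(** * Chernoff's bound and the three tails *)

Lemma walk_chernoff (R : realType) (n k T : nat) (M : 'M[R]_n) (pi phi : 'rV[R]_n)
    (d : measure_display) (Omega : measurableType d) (P : probability Omega R)
    (V : 'I_k.+1 -> Omega -> 'I_n) (f : 'I_k.+1 -> 'I_n -> R)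
    (mu s a : R) (B : pred {ffun 'I_k.+1 -> 'I_n}) :
  (forall i, 0 < pi 0 i) -> mass pi = 1 -> stochastic M -> pi *m M = pi ->
  (forall u, mass u = 0 -> 2 * pi_norm pi (u *m M ^+ T.+1) <= pi_norm pi u) ->
  is_distribution phi -> is_random_walk P M phi V ->
  (forall i v, 0 <= f i v <= 1) -> (forall i, mean pi (f i) = mu) ->
  `|s| <= 1 / 18 -> (forall v, B v -> 0 <= s * (\sum_i f i (v i) - a)) ->
  (P [set w | B [ffun i => V i w]] <=
   (2 * expR 1 * pi_norm pi phi *
    expR ((k.+1%:R * (s * mu + 10 * s ^+ 2 * mu) - s * a) / T.+1%:R))%:E)%E.
Proof.
move=> pi0 pi1 sM piM ctr dphi walk f01 fmu s18 Ba.
(* The sign of [s] selects the tail: on [B] the sum lies beyond [a] in the direction of [s]. *)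
pose X (v : {ffun 'I_k.+1 -> 'I_n}) := s * (\sum_i f i (v i) - a) / T.+1%:R.
apply: le_trans (walk_markov (X := X) walk sM dphi _) _.
  by move=> v /Ba h; rewrite divr_ge0.
rewrite lee_fin; have := exponential_moment pi0 pi1 sM piM f01 fmu s18 dphi ctr.
move=> /(ler_wpM2r (expR_ge0 (- (s * a) / T.+1%:R))).
rewrite big_distrl /= -[leRHS]mulrA -expRD => h.
rewrite [leLHS](_ : _ = \sum_v path_weight M phi v *
    expR (s / T.+1%:R * (\sum_i f i (v i))) * expR (- (s * a) / T.+1%:R)); last first.
  apply: eq_bigr => v _; rewrite -mulrA -expRD; congr (_ * expR _).
  by rewrite /X; ring.
apply: le_trans h _; rewrite le_eqVlt; apply/orP; left; apply/eqP.
by congr (_ * expR _); ring.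
Qed.

Theorem theorem3p1 (R : realType) :
  exists c : R,
  forall (n : nat) (M : 'M[R]_n) (pi : 'rV[R]_n) (eps : R) (T : nat)
         (t : nat) (phi : 'rV[R]_n)
         (d : measure_display) (Omega : measurableType d)
         (P : probability Omega R) (V : 'I_t -> Omega -> 'I_n)
         (f : 'I_t -> 'I_n -> R) (mu : R),
    is_ergodic M ->
    is_stationary M pi ->
    0 < eps -> eps <= 1 / 8 ->
    is_mixing_time M pi eps T ->
    (0 < t)%N ->
    is_distribution phi ->
    is_random_walk P M phi V ->
    (forall i v, 0 <= f i v <= 1) ->
    (forall i, mean pi (f i) = mu) ->
    [/\ forall delta : R, 0 <= delta -> delta <= 1 ->
          (P [set w | ((1 + delta) * mu * t%:R <= total_weight f V w)%R]
           <= (c * pi_norm pi phi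
               * expR (- (delta ^+ 2 * mu * t%:R / (72 * T%:R))))%:E)%E,
        forall delta : R, 1 < delta ->
          (P [set w | ((1 + delta) * mu * t%:R <= total_weight f V w)%R]
           <= (c * pi_norm pi phi
               * expR (- (delta * mu * t%:R / (72 * T%:R))))%:E)%E
      & forall delta : R, 0 <= delta -> delta <= 1 ->
          (P [set w | (total_weight f V w <= (1 - delta) * mu * t%:R)%R]
           <= (c * pi_norm pi phi
               * expR (- (delta ^+ 2 * mu * t%:R / (72 * T%:R))))%:E)%E].
Proof.
exists (2 * expR 1) => n M pi eps T t phi d Omega P V f mu.
move=> [tM irr _] st eps0 eps8 [T1 mix _] t0 dphi walk f01 fmu.
(* [T] and [t] are positive, and the lemmas above are indexed by their predecessors. *)
case: T T1 mix => // T _ mix; case: t t0 V f walk f01 fmu => // k _ V f walk f01 fmu.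
have pi0 := stationary_gt0 tM irr st.
have sM := transition_stochastic tM.
have [[_ pi1] piM] := st; rewrite -/(mass pi) in pi1.
have ctr := mixed_pi_contraction pi0 pi1 sM piM (ltW eps0) eps8 mix.
(* Common to the three bounds, with [x] being [delta ^+ 2] or [delta]; the last premise compares the
   exponents before division by the mixing time. *)
have tail s a x (B : pred {ffun 'I_k.+1 -> 'I_n}) :
    `|s| <= 1 / 18 -> (forall v, B v -> 0 <= s * (\sum_i f i (v i) - a)) ->
    k.+1%:R * (s * mu + 10 * s ^+ 2 * mu) - s * a <= - (x * mu * k.+1%:R / 72) ->
    (P [set w | B [ffun i => V i w]] <=
     (2 * expR 1 * pi_norm pi phi * expR (- (x * mu * k.+1%:R / (72 * T.+1%:R))))%:E)%E.
  move=> s18 Ba le.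
  apply: le_trans (walk_chernoff pi0 pi1 sM piM ctr dphi walk f01 fmu s18 Ba) _.
  rewrite lee_fin; apply: ler_wpM2l; first by rewrite !mulr_ge0 ?expR_ge0 ?pi_norm_ge0.
  have -> : x * mu * k.+1%:R / (72 * T.+1%:R) = x * mu * k.+1%:R / 72 / T.+1%:R.
    by rewrite invfM mulrA.
  by rewrite ler_expR -[leRHS]mulNr ler_pM2r ?invr_gt0 ?ltr0n.
have /andP[mu0 _] := mean_ge0_le1 pi0 pi1 (f01 ord0) (fmu ord0).
have w0 : 0 <= mu * k.+1%:R by rewrite mulr_ge0.
have weightE w : \sum_i f i ([ffun i => V i w] i) = total_weight f V w.
  by apply: eq_bigr => i _; rewrite ffunE.
split=> delta.
- move=> d0 d1.
  have := tail (delta / 18) ((1 + delta) * mu * k.+1%:R) (delta ^+ 2)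
    (fun v => (1 + delta) * mu * k.+1%:R <= \sum_i f i (v i)).
  under eq_set do rewrite weightE.
  apply.
  + by rewrite ger0_norm; lra.
  + by move=> v h; rewrite mulr_ge0 ?subr_ge0 //; lra.
  (* Per unit of [mu * t] the exponent is [10 * s ^+ 2 - s * delta = - (2 / 81) * delta ^+ 2], below
     [- delta ^+ 2 / 72]. *)
  + by have := mulr_ge0 (sqr_ge0 delta) w0; nra.
- move=> d1.
  have := tail (1 / 18) ((1 + delta) * mu * k.+1%:R) delta
    (fun v => (1 + delta) * mu * k.+1%:R <= \sum_i f i (v i)).
  under eq_set do rewrite weightE.
  apply.
  + by rewrite ger0_norm; lra.
  + by move=> v h; rewrite mulr_ge0 ?subr_ge0 //; lra.
  (* Per unit of [mu * t] the exponent is [10 / 324 - delta / 18], and [10 / 324 <= delta / 24] as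
     [delta > 1]. *)
  + have d0 : 0 <= delta - 1 by lra.
    by have := mulr_ge0 d0 w0; nra.
- move=> d0 d1.
  have := tail (- (delta / 18)) ((1 - delta) * mu * k.+1%:R) (delta ^+ 2)
    (fun v => \sum_i f i (v i) <= (1 - delta) * mu * k.+1%:R).
  under eq_set do rewrite weightE.
  apply.
  + by rewrite normrN ger0_norm; lra.
  + by move=> v h; rewrite mulr_le0 ?subr_le0 //; lra.
  (* Changing the signs of both [s] and the deviation gives the same exponent as for the upper
     tail. *)
  + by have := mulr_ge0 (sqr_ge0 delta) w0; nra.
Qed.
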